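(* Let $Z$ be a closed convex set, let $H$ be a field on $Z$ and $G$ a function on $Z$ such that, with constants $M>0$, $\delta>0$, $L>0$: (i) $\langle H(z_2)-H(z_1),z_2-z_1\rangle\ge 0$ for all $z_1,z_2\in Z$, and $$\langle H(z_1)-H(z_2),z_1-z_3\rangle\le \tfrac M2\|z_1-z_2\|^2+\tfrac M2\|z_1-z_3\|^2+\delta\qquad\forall z_1,z_2,z_3\in Z;$$ (ii) $G$ is differentiable, convex and $L$-smooth: $0\le G(z_2)-G(z_1)-\langle\nabla G(z_1),z_2-z_1\rangle\le\frac L2\|z_2-z_1\|^2$ for all $z_1,z_2\in Z$. Run the mirror-prox sliding (MPS) method (described in the context) with parameters $$\gamma_k=\frac{2}{k+1},\quad \beta_k=\frac{2L}{k},\quad T_k=\left\lceil\frac{kM}{L}\right\rceil,\quad \eta_k^t=\beta_k(t-1)+\frac{LT_k}{k}.$$ Then, for $\varepsilon>0$, in order to compute an approximate solution $\overline z_N$ such that $\sup_{z\in Z}Q(\overline z_N,z)\le\varepsilon+\delta$, the numbers $N_{\nabla G}$ and $N_H$ of evaluations of the gradient $\nabla G(\cdot)$ and of the operator $H(\cdot)$ are bounded respectively by $$N_{\nabla G}=O\left(\sqrt{\frac{L\Omega_{z_0}^2}{\varepsilon}}\right),\qquad N_H=O\left(\frac{M\Omega_{z_0}^2}{\varepsilon}+\sqrt{\frac{L\Omega_{z_0}^2}{\varepsilon}}\right),$$ where $\Omega_{z_0}^2=\sup_{z\in Z}V(z_0,z)$.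
   Context: $\|\cdot\|$ is the $\ell_2$-norm. $d$ is a (differentiable) prox-function that is $1$-strongly convex with respect to $\|\cdot\|$, and $V(x,y)=d(y)-d(x)-\langle\nabla d(x),y-x\rangle$ is the associated Bregman divergence (first argument is the prox-center). The problem considered is the variational inequality: find $z^*\in Z$ with $\langle H(z)+\nabla G(z),z^*-z\rangle\le 0$ for all $z\in Z$. The accuracy measure is $$Q(z_1,z_2)=G(z_1)-G(z_2)+\langle H(z_2),z_1-z_2\rangle .$$ MPS method. Input: $z_0\in Z$, number $N$ of outer steps, inner step numbers $T_k$, parameters $\beta_k,\eta_k^t,\gamma_k$ ($1\le k\le N$, $1\le t\le T_k$). Set $\overline z_0=z_0$. For $k=1,\dots,N$: compute $\underline z_k=(1-\gamma_k)\overline z_{k-1}+\gamma_kz_{k-1}$ and set $z_k^0=z_{k-1}$; for $t=1,\dots,T_k$ compute $$\tilde z_k^t=\operatorname*{argmin}_{z\in Z}\ \langle\nabla G(\underline z_k)+H(z_k^{t-1}),z\rangle+\beta_kV(z_{k-1},z)+\eta_k^tV(z_k^{t-1},z),$$ $$z_k^t=\operatorname*{argmin}_{z\in Z}\ \langle\nabla G(\underline z_k)+H(\tilde z_k^t),z\rangle+\beta_kV(z_{k-1},z)+\eta_k^tV(z_k^{t-1},z);$$ then set $z_k=z_k^{T_k}$, $\tilde z_k=\frac1{T_k}\sum_{t=1}^{T_k}\tilde z_k^t$ and $\overline z_k=(1-\gamma_k)\overline z_{k-1}+\gamma_k\tilde z_k$. Output: $\overline z_N$. The gradient $\nabla G(\underline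 z_k)$ is evaluated once per outer step $k$. $O(\cdot)$ hides absolute constants; as counts are positive integers, the bounds are understood in the regime where $L\Omega_{z_0}^2/\varepsilon\ge1$. *)

(* Defs.v *)
From HB Require Import structures.
From mathcomp Require Import all_boot all_order all_algebra.
From mathcomp Require Import all_classical all_reals all_analysis.

Set Implicit Arguments.
Unset Strict Implicit.
Unset Printing Implicit Defensive.

Import Order.TTheory GRing.Theory Num.Theory.
Import numFieldNormedType.Exports.

Local Open Scope classical_set_scope.
Local Open Scope ring_scope.

Section Euclidean.
Context {R : realType} {n : nat}.
Local Notation E := 'rV[R]_n.

Definition dotp (u v : E) : R := (u *m v^T) 0 0.

(* The norm `|u| of the library on 'rV[R]_n is the max norm; it induces the same
   topology as l2norm, so [closed] and [nbhs] are unambiguous. *)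
Definition l2norm (u : E) : R := Num.sqrt (dotp u u).

(* Differentiability relative to Z: only the values of f on Z matter, and Z may
   have empty interior, in which case the gradient need not be unique. *)
Definition is_gradient_on (Z : set E) (f : E -> R) (gradf : E -> E) : Prop :=
  forall x, Z x -> forall e : R, 0 < e ->
    \forall y \near within Z (nbhs x),
      `|f y - f x - dotp (gradf x) (y - x)| <= e * l2norm (y - x).

Definition strongly_convex_on (Z : set E) (mu : R) (f : E -> R) : Prop :=
  forall x y, Z x -> Z y -> forall t : R, 0 <= t <= 1 ->
    f (t *: x + (1 - t) *: y) <=
      t * f x + (1 - t) * f y - mu / 2 * t * (1 - t) * l2norm (x - y) ^+ 2.

Definition argmin_on (Z : set E) (f : E -> R) : set E :=
  [set x | Z x /\ forall y, Z y -> f x <= f y].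

(* The first argument is the prox-center. *)
Definition bregman (d : E -> R) (gradd : E -> E) (x y : E) : R :=
  d y - d x - dotp (gradd x) (y - x).

Definition gap (G : E -> R) (H : E -> E) (z1 z2 : E) : R :=
  G z1 - G z2 + dotp (H z2) (z1 - z2).

End Euclidean.

Record mps_params (R : realType) := MpsParams {
  gamma : nat -> R;
  beta : nat -> R;
  inner_steps : nat -> nat;
  eta : nat -> nat -> R }.

Record mps_iterates (R : realType) (n : nat) := MpsIterates {
  z : nat -> 'rV[R]_n;
  zlow : nat -> 'rV[R]_n;           (* underlined z_k *)
  zbar : nat -> 'rV[R]_n;           (* overlined z_k *)
  ztil : nat -> 'rV[R]_n;           (* averaged tilde z_k *)
  zin : nat -> nat -> 'rV[R]_n;     (* z_k^t *)
  ztilin : nat -> nat -> 'rV[R]_n   (* tilde z_k^t *) }.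

Section MPS.
Context {R : realType} {n : nat}.
Local Notation E := 'rV[R]_n.
Variables (Z : set E) (H gradG : E -> E) (V : E -> E -> R).

(* The function minimized by both inner updates of outer step k: H is queried at
   [w], the prox-centers are [zprev] = z_{k-1} and [zcur] = z_k^{t-1}. *)
Definition mps_objective (b e : R) (zl w zprev zcur x : E) : R :=
  dotp (gradG zl + H w) x + b * V zprev x + e * V zcur x.

(* [mps_run p z0 N s]: the points recorded in s are iterates of the first N outer
   steps; entries of s outside the index ranges below are irrelevant. *)
Record mps_run (p : mps_params R) (z0 : E) (N : nat) (s : mps_iterates R n) :
    Prop := MpsRun {
  run_z0 : z s 0 = z0;
  run_zbar0 : zbar s 0 = z0;
  run_zlow : forall k, (1 <= k <= N)%N ->
    zlow s k = (1 - gamma p k) *: zbar s k.-1 + gamma p k *: z s k.-1;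
  run_zin0 : forall k, (1 <= k <= N)%N -> zin s k 0 = z s k.-1;
  run_ztilin : forall k t, (1 <= k <= N)%N -> (1 <= t <= inner_steps p k)%N ->
    argmin_on Z (mps_objective (beta p k) (eta p k t) (zlow s k)
                   (zin s k t.-1) (z s k.-1) (zin s k t.-1)) (ztilin s k t);
  run_zin : forall k t, (1 <= k <= N)%N -> (1 <= t <= inner_steps p k)%N ->
    argmin_on Z (mps_objective (beta p k) (eta p k t) (zlow s k)
                   (ztilin s k t) (z s k.-1) (zin s k t.-1)) (zin s k t);
  run_z : forall k, (1 <= k <= N)%N -> z s k = zin s k (inner_steps p k);
  run_ztil : forall k, (1 <= k <= N)%N ->
    ztil s k =
      (inner_steps p k)%:R^-1 *: \sum_(1 <= t < (inner_steps p k).+1) ztilin s k t;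
  run_zbar : forall k, (1 <= k <= N)%N ->
    zbar s k = (1 - gamma p k) *: zbar s k.-1 + gamma p k *: ztil s k }.

End MPS.

Section OracleCalls.
Context {R : realType} {n : nat}.
Variables (p : mps_params R) (N : nat) (s : mps_iterates R n).

(* The points at which the gradient of G, resp. H, is evaluated during N outer
   steps, in order and with multiplicity: the gradient once per outer step, H once
   for each of the two updates of every inner step. *)
Definition gradG_calls : seq 'rV[R]_n := [seq zlow s k | k <- iota 1 N].

Definition H_calls : seq 'rV[R]_n :=
  flatten [seq flatten [seq [:: zin s k t.-1; ztilin s k t]
                           | t <- iota 1 (inner_steps p k)]
              | k <- iota 1 N].

End OracleCalls.

Definition sliding_params (R : realType) (L M : R) : mps_params R :=
  let gamma k := 2 / k.+1%:R in
  let beta k := 2 * L / k%:R in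
  let T k := `|Num.ceil (k%:R * M / L)|%N in
  let eta k t := beta k * (t%:R - 1) + L * (T k)%:R / k%:R in
  MpsParams gamma beta T eta.

(* Main.v *)
Require Import Defs.
From HB Require Import structures.
From mathcomp Require Import all_boot all_order all_algebra.
From mathcomp Require Import all_classical all_reals all_analysis.
From mathcomp Require Import ring lra.

Set Implicit Arguments.
Unset Strict Implicit.
Unset Printing Implicit Defensive.

Import Order.TTheory GRing.Theory Num.Theory.
Import numFieldNormedType.Exports.

Local Open Scope classical_set_scope.
Local Open Scope ring_scope.

(** The proof is an energy argument with three layers, each carrying the Bregman
distances to a fixed comparison point y of Z.

A prox step obeys a three-point inequality ([prox_three_point]), obtained from
the first-order optimality condition along segments of Z. Two prox steps from
the same center, with H queried first at the center and then at the intermediate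
point, make one extragradient step: adding their three-point inequalities leaves
only the cross term < H x - H a, x - x' >, which the growth condition on H bounds
by M V(a, x) + M V(x, x') + delta, and these distances occur on the favourable
side with weights at least eta >= M ([extragradient_step]).

The parameters satisfy eta_(t+1) = eta_t + beta, so the inner inequalities
telescope ([inner_loop]). Dividing by T gives an inequality for the average of
the intermediate points, with the quadratic term beta / 2 |.|^2 on the left
([inner_loop_mean]). Smoothness of G turns the gradient inequality at the
extrapolated point into a contraction of the gap, and costs a quadratic term
L gamma / 2 |.|^2, which is absorbed because L gamma_k <= beta_k ([outer_step]).
With beta_k + eta_k^1 / T_k = 3 L / k, multiplication by k (k + 1) / 2 makes the
outer inequalities telescope as well ([mps_run_gap]), whence
  Q(zbar_N, y) <= 6 L V(z_0, y) / (N (N + 1)) + delta.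

So N = ceil (3 x) outer steps suffice, where x = sqrt (L Omega^2 / eps) >= 1;
then N <= 4 x, and summing 2 T_k <= 2 (k M / L + 1) over k <= N yields the number
of evaluations of H. *)

(** * Euclidean inner product *)

Section InnerProduct.
Context {R : realType} {n : nat}.
Implicit Types u v w : 'rV[R]_n.

Lemma dotpE u v : dotp u v = \sum_i u 0 i * v 0 i.
Proof. by rewrite /dotp mxE; apply: eq_bigr => i _; rewrite mxE. Qed.

Lemma dotpC u v : dotp u v = dotp v u.
Proof. by rewrite !dotpE; apply: eq_bigr => i _; rewrite mulrC. Qed.

Lemma dotpDl u v w : dotp (u + v) w = dotp u w + dotp v w.
Proof. by rewrite /dotp mulmxDl mxE. Qed.

Lemma dotpZl (a : R) u v : dotp (a *: u) v = a * dotp u v.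
Proof. by rewrite /dotp -scalemxAl mxE. Qed.

Lemma dotpNl u v : dotp (- u) v = - dotp u v.
Proof. by rewrite -scaleN1r dotpZl mulN1r. Qed.

Lemma dotpDr u v w : dotp u (v + w) = dotp u v + dotp u w.
Proof. by rewrite !(dotpC u) dotpDl. Qed.

Lemma dotpZr (a : R) u v : dotp u (a *: v) = a * dotp u v.
Proof. by rewrite !(dotpC u) dotpZl. Qed.

Lemma dotpNr u v : dotp u (- v) = - dotp u v.
Proof. by rewrite !(dotpC u) dotpNl. Qed.

Lemma dotp0r u : dotp u 0 = 0.
Proof. by rewrite -(scale0r u) dotpZr mul0r. Qed.

Definition dotp_linE := (dotpDl, dotpDr, dotpNl, dotpNr, dotpZl, dotpZr).

Lemma dotp_ge0 u : 0 <= dotp u u.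
Proof. by rewrite dotpE; apply: sumr_ge0 => i _; rewrite -expr2 sqr_ge0. Qed.

Lemma sqr_l2norm u : l2norm u ^+ 2 = dotp u u.
Proof. by rewrite sqr_sqrtr // dotp_ge0. Qed.

Lemma l2normB u v : l2norm (u - v) = l2norm (v - u).
Proof. by rewrite /l2norm -opprB dotpNl dotpNr opprK. Qed.

Lemma l2normZ (a : R) u : 0 <= a -> l2norm (a *: u) = a * l2norm u.
Proof.
move=> a0; rewrite /l2norm dotpZl dotpZr mulrA -expr2 sqrtrM ?sqr_ge0//.
by rewrite sqrtr_sqr ger0_norm.
Qed.

(** Affine minorants of the squared norm. Replacing the norm by the minorant with
slope w keeps an inequality affine in u, so that it can be summed; choosing w at
the end as the mean gives Jensen's inequality. *)
Lemma sqr_l2norm_tangent w u : dotp w u - dotp w w / 2 <= l2norm u ^+ 2 / 2.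
Proof.
by have := dotp_ge0 (u - w); rewrite sqr_l2norm !dotp_linE (dotpC u w); lra.
Qed.

End InnerProduct.

(** * Convex sets and gradients along segments *)

Section ConvexSets.
Context {R : realType} {n : nat}.
Variable Z : set 'rV[R]_n.
Hypothesis cvxZ : convex_set Z.

Lemma convex_comb x y (t : R) : Z x -> Z y -> 0 <= t <= 1 ->
  Z ((1 - t) *: x + t *: y).
Proof.
move=> Zx Zy t01; rewrite addrC.
have Ht : Itv.spec (@Itv.num_sem R) (Itv.Real `[0%Z, 1%Z]) t.
  by rewrite /Itv.spec/= /Itv.num_sem /= ger0_real ?in_itv//=; case/andP: t01.
have := @cvxZ y x (Itv.mk Ht).
by rewrite !inE; apply.
Qed.

Lemma convex_segment x y (t : R) : Z x -> Z y -> 0 <= t <= 1 ->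
  Z (x + t *: (y - x)).
Proof.
move=> Zx Zy t01; rewrite (_ : _ + _ = (1 - t) *: x + t *: y).
  exact: convex_comb.
by rewrite scalerBr scalerBl scale1r addrA addrAC.
Qed.

Lemma convex_mean (f : nat -> 'rV[R]_n) m : (0 < m)%N ->
  (forall t, (1 <= t <= m)%N -> Z (f t)) ->
  Z (m%:R^-1 *: \sum_(1 <= t < m.+1) f t).
Proof.
elim: m => // -[_ _ Zf|m IHm _ Zf].
  by rewrite big_nat1 invr1 scale1r; exact: Zf.
rewrite big_nat_recr//= scalerDr.
rewrite (_ : _ *: _ = (1 - m.+2%:R^-1) *:
    (m.+1%:R^-1 *: \sum_(1 <= t < m.+2) f t)); last first.
  rewrite scalerA; congr (_ *: _).
  have : 0 < m.+1%:R :> R by rewrite ltr0n.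
  rewrite -(natr1 m.+1); move: (m.+1%:R : R) => q q0.
  by field; rewrite !gt_eqF// addr_gt0.
apply: convex_comb; last by rewrite invr_ge0 ler0n invf_le1 ?ltr0n// ler1n.
- by apply: IHm => // t /andP[t1 tm]; apply: Zf; rewrite t1 leqW.
- by apply: Zf; rewrite leqnn.
Qed.

(** All that first-order arguments need of a gradient relative to Z: arbitrarily
short moves from x towards another point of Z stay in Z, and f is there linear up
to an error of slope e. The threshold tau lets second-order terms be discarded. *)
Lemma gradient_along_segment f gradf x y (e tau : R) :
  is_gradient_on Z f gradf -> Z x -> Z y -> 0 < e -> 0 < tau <= 1 ->
  exists t, [/\ 0 < t <= tau, Z (x + t *: (y - x)) &
    `|f (x + t *: (y - x)) - f x - t * dotp (gradf x) (y - x)| <= t * e].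
Proof.
move=> df Zx Zy e0 /andP[tau0 tau1].
pose v : 'rV[R]_n := y - x; rewrite -/v.
have nv : 0 < 1 + l2norm v by rewrite ltr_pwDl// sqrtr_ge0.
have := df x Zx (e / (1 + l2norm v)) (divr_gt0 e0 nv).
rewrite near_withinE => near_x.
have path_cvg : x + t *: v @[t --> 0^'+] --> x.
  have : x + t *: v @[t --> 0^'+] --> x + 0 *: v.
    apply: cvgD; first exact: cvg_cst.
    by apply: cvgZr_tmp; apply: cvg_at_right_filter; exact: cvg_id.
  by rewrite scale0r addr0.
have /path_cvg near_0 := near_x.
have [t []] : exists t : R, (0 < t <= tau) /\ (Z (x + t *: v) ->
    `|f (x + t *: v) - f x - dotp (gradf x) (x + t *: v - x)|
    <= e / (1 + l2norm v) * l2norm (x + t *: v - x)).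
  near (0 : R)^'+ => t; exists t; split.
    by apply/andP; split; [near: t; exact: nbhs_right_gt
                          |near: t; exact: nbhs_right_le].
  by near: t; exact: near_0.
move=> /andP[t0 ttau] H.
have Zt : Z (x + t *: v).
  by apply: convex_segment; rewrite // (ltW t0)/= (le_trans ttau).
exists t; split => //; first by rewrite t0.
move: (H Zt); have -> : x + t *: v - x = t *: v by rewrite addrAC subrr add0r.
rewrite l2normZ ?(ltW t0)// dotpZr.
move=> /le_trans; apply.
rewrite mulrCA ler_pM2l// mulrAC ler_pdivrMr// ler_pM2l//.
by rewrite lerDr.
Unshelve. all: by end_near. Qed.

End ConvexSets.

(** * Bregman distances and prox steps *)

Section Prox.
Context {R : realType} {n : nat}.
Variables (Z : set 'rV[R]_n) (d : 'rV[R]_n -> R) (gradd : 'rV[R]_n -> 'rV[R]_n).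
Hypothesis cvxZ : convex_set Z.
Hypothesis d_grad : is_gradient_on Z d gradd.
Local Notation V := (bregman d gradd).

(** Compare the strong convexity inequality at distance t from x with the first
order expansion there, divide by t, and let t tend to 0. *)
Lemma bregman_ge (mu : R) x y : 0 <= mu -> strongly_convex_on Z mu d ->
  Z x -> Z y -> mu / 2 * l2norm (y - x) ^+ 2 <= V x y.
Proof.
move=> mu0 scd Zx Zy; apply/ler_addgt0Pr => e e0.
pose c : R := mu * l2norm (y - x) ^+ 2.
have c0 : 0 <= c by rewrite mulr_ge0 ?sqr_ge0.
(* The threshold makes the term t * c, which vanishes with t, at most e. *)
have tau01 : 0 < Num.min 1 (e / (1 + c)) <= 1.
  by rewrite lt_min ltr01 divr_gt0//= ?ge_min ?lexx// ltr_pwDl.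
have e2 : 0 < e / 2 by rewrite divr_gt0.
have [t [/andP[t0 ttau] Zt dt]] :=
  gradient_along_segment cvxZ d_grad Zx Zy e2 tau01.
move: ttau; rewrite le_min => /andP[t1 te].
have tc : t * c <= e.
  rewrite ler_pdivlMr ?ltr_pwDl// in te.
  by rewrite (le_trans _ te)// ler_pM2l// lerDr.
have := scd y x Zy Zx t; rewrite (ltW t0) t1 => /(_ isT).
rewrite (_ : t *: y + _ = x + t *: (y - x)); last first.
  by rewrite scalerBr scalerBl scale1r addrCA.
rewrite -/c => sc; move: dt => /ler_normlP[dt _].
rewrite -(ler_pM2l t0) /bregman.
rewrite -/c.
have {sc} : d (x + t *: (y - x)) <=
    t * d y + (1 - t) * d x - t * ((1 - t) * c / 2).
  by apply: (le_trans sc); rewrite /c; lra.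
have : t * (t * c) <= t * e by rewrite ler_pM2l.
move: dt; rewrite /c; lra.
Qed.

(** The minimality of x along the segment towards y bounds from below the
directional derivative of the objective at x. Expanding the gradients of the two
Bregman terms with the identity
< gradd u - gradd x, y - x > = V(u, x) + V(x, y) - V(u, y) gives the inequality. *)
Lemma prox_three_point (xi u a x y : 'rV[R]_n) (b c : R) :
  Z u -> Z a -> 0 <= b -> 0 <= c ->
  argmin_on Z (fun w => dotp xi w + b * V u w + c * V a w) x -> Z y ->
  dotp xi (x - y) + b * V u x + c * V a x + (b + c) * V x y
    <= b * V u y + c * V a y.
Proof.
move=> Zu Za b0 c0 [Zx xmin] Zy; apply/ler_addgt0Pr => e e0.
have bc : 0 < 1 + (b + c) by rewrite ltr_pwDl// addr_ge0.
have tau01 : 0 < (1 : R) <= 1 by rewrite ltr01 lexx.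
have [t [/andP[t0 _] Zt dt]] :=
  gradient_along_segment cvxZ d_grad Zx Zy (divr_gt0 e0 bc) tau01.
have := xmin _ Zt; move: dt => /ler_normlP[_ dt].
rewrite /bregman !dotp_linE => opt.
rewrite !dotp_linE in dt.
have err : (b + c) * (e / (1 + (b + c))) <= e.
  by rewrite mulrA ler_pdivrMr// mulrC ler_pM2l// lerDr.
have dt' := ler_wpM2l (addr_ge0 b0 c0) dt.
have err' : t * ((b + c) * (e / (1 + (b + c)))) <= t * e by rewrite ler_pM2l.
rewrite -(ler_pM2l t0).
move: opt dt' err'; lra.
Qed.

End Prox.

(** * The mirror-prox sliding iteration *)

Lemma natr_ceil_bounds (R : realType) (a : R) : 0 <= a ->
  a <= (`|Num.ceil a|%N)%:R <= a + 1.
Proof.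
move=> a0; rewrite natr_absz ger0_norm; last first.
  by rewrite ceil_ge0 (lt_le_trans (ltrN10 R)).
rewrite ceil_ge/= -lerBlDr ltW//.
by have := ceilB1_lt a; rewrite intrB.
Qed.

Section Sliding.
Context {R : realType} {n : nat}.
Variables (Z : set 'rV[R]_n) (d : 'rV[R]_n -> R) (gradd : 'rV[R]_n -> 'rV[R]_n).
Variables (H gradG : 'rV[R]_n -> 'rV[R]_n) (G : 'rV[R]_n -> R) (M L delta : R).
Local Notation V := (bregman d gradd).
Hypothesis cvxZ : convex_set Z.
Hypothesis d_grad : is_gradient_on Z d gradd.
Hypothesis d_scvx : strongly_convex_on Z 1 d.
Hypothesis M_gt0 : 0 < M.
Hypothesis L_gt0 : 0 < L.
Hypothesis H_mono :
  forall z1 z2, Z z1 -> Z z2 -> 0 <= dotp (H z2 - H z1) (z2 - z1).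
Hypothesis H_bound : forall z1 z2 z3, Z z1 -> Z z2 -> Z z3 ->
  dotp (H z1 - H z2) (z1 - z3) <=
    M / 2 * l2norm (z1 - z2) ^+ 2 + M / 2 * l2norm (z1 - z3) ^+ 2 + delta.
Hypothesis G_smooth : forall z1 z2, Z z1 -> Z z2 ->
  0 <= G z2 - G z1 - dotp (gradG z1) (z2 - z1) <= L / 2 * l2norm (z2 - z1) ^+ 2.

Local Notation mps_obj := (mps_objective H gradG V).

Let V_ge x y : Z x -> Z y -> l2norm (y - x) ^+ 2 / 2 <= V x y.
Proof.
move=> Zx Zy; have := bregman_ge cvxZ d_grad ler01 d_scvx Zx Zy.
by rewrite mul1r mulrC.
Qed.

(** One inner step, from a to the intermediate point x and then to x'. The
three-point inequality of the first prox step is used at x', that of the second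
one at y. Monotonicity replaces H x by H y, so that the left side is affine
in x, the term beta V(u, x) being bounded below by its affine minorant of slope w. *)
Lemma extragradient_step (b e : R) zl u a x x' w y :
  0 <= b -> M <= e -> Z u -> Z a -> Z y ->
  argmin_on Z (mps_obj b e zl a u a) x ->
  argmin_on Z (mps_obj b e zl x u a) x' ->
  dotp (gradG zl + H y) (x - y) + b * (dotp w (x - u) - dotp w w / 2)
    + (b + e) * V x' y <= b * V u y + e * V a y + delta.
Proof.
move=> b0 Me Zu Za Zy minx minx'.
have e0 : 0 <= e by rewrite (le_trans _ Me)// ltW.
have [Zx _] := minx; have [Zx' _] := minx'.
have := prox_three_point cvxZ d_grad Zu Za b0 e0 minx Zx'.
have := prox_three_point cvxZ d_grad Zu Za b0 e0 minx' Zy.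
have := H_bound Zx Za Zx'.
have := H_mono Zy Zx.
have Vax := V_ge Za Zx.
have Vxx' := V_ge Zx Zx'.
have Vux := ler_wpM2l b0 (le_trans (sqr_l2norm_tangent w (x - u)) (V_ge Zu Zx)).
have Vax0 : 0 <= V a x by apply: le_trans Vax; rewrite divr_ge0 ?sqr_ge0.
have Vxx'0 : 0 <= V x x' by apply: le_trans Vxx'; rewrite divr_ge0 ?sqr_ge0.
have be : M <= b + e by rewrite (le_trans Me)// lerDr.
have MVax := le_trans (ler_wpM2l (ltW M_gt0) Vax) (ler_wpM2r Vax0 Me).
have MVxx' := le_trans (ler_wpM2l (ltW M_gt0) Vxx') (ler_wpM2r Vxx'0 be).
rewrite (l2normB x x').
move: Vux MVax MVxx'; rewrite !dotp_linE; lra.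
Qed.

(** The weight e_t = b (t - 1) + e0 of V(a (t - 1), y) in the t-th inequality
satisfies e_t + b = e_(t+1), the weight with which V(a t, y) then reappears. *)
Lemma inner_loop (b e0 : R) zl u (a x : nat -> 'rV[R]_n) w y T :
  0 <= b -> M <= e0 -> Z u -> Z y -> a 0 = u ->
  (forall t, (1 <= t <= T)%N ->
    argmin_on Z (mps_obj b (b * (t%:R - 1) + e0) zl (a t.-1) u (a t.-1)) (x t)) ->
  (forall t, (1 <= t <= T)%N ->
    argmin_on Z (mps_obj b (b * (t%:R - 1) + e0) zl (x t) u (a t.-1)) (a t)) ->
  dotp (gradG zl + H y) (\sum_(1 <= t < T.+1) x t - T%:R *: y)
    + b * (dotp w (\sum_(1 <= t < T.+1) x t - T%:R *: u) - T%:R * (dotp w w / 2))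
    + (b * T%:R + e0) * V (a T) y
  <= (b * T%:R + e0) * V u y + T%:R * delta.
Proof.
move=> b0 Me Zu Zy a0; elim: T => [_ _|T IHT minx mina].
  by rewrite big_geq// !scale0r subr0 !dotp0r mulr0 mul0r a0; lra.
have sub t : (1 <= t <= T)%N -> (1 <= t <= T.+1)%N.
  by move=> /andP[-> tT]; rewrite leqW.
have {}IHT := IHT (fun t tT => minx t (sub t tT)) (fun t tT => mina t (sub t tT)).
have eT : M <= b * (T.+1%:R - 1) + e0.
  by rewrite -[T.+1%:R]natr1 addrK (le_trans Me)// lerDr mulr_ge0.
have Za : Z (a T).
  by case: T mina {IHT minx sub eT} => [|T] mina;
    [rewrite a0 | case: (mina T.+1) => //=; rewrite leqnSn].
have inT : (1 <= T.+1 <= T.+1)%N by rewrite leqnn.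
have := extragradient_step w b0 eT Zu Za Zy (minx _ inT) (mina _ inT).
rewrite -[T.+1%:R]natr1 (big_nat_recr T.+1)//= => step; move: IHT step.
by rewrite !dotp_linE; lra.
Qed.

(** The slope w in [inner_loop] is taken to be xm - u, for which the affine
minorant of the squared norm is exact at the mean xm. *)
Lemma inner_loop_mean (b e0 : R) zl u (a x : nat -> 'rV[R]_n) y T :
  let xm := T%:R^-1 *: \sum_(1 <= t < T.+1) x t in
  (0 < T)%N -> 0 <= b -> M <= e0 -> Z u -> Z y -> a 0 = u ->
  (forall t, (1 <= t <= T)%N ->
    argmin_on Z (mps_obj b (b * (t%:R - 1) + e0) zl (a t.-1) u (a t.-1)) (x t)) ->
  (forall t, (1 <= t <= T)%N ->
    argmin_on Z (mps_obj b (b * (t%:R - 1) + e0) zl (x t) u (a t.-1)) (a t)) ->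
  dotp (gradG zl + H y) (xm - y) + b / 2 * l2norm (xm - u) ^+ 2
  <= (b + e0 / T%:R) * (V u y - V (a T) y) + delta.
Proof.
move=> xm T0 b0 Me Zu Zy a0 minx mina.
have := inner_loop (xm - u) b0 Me Zu Zy a0 minx mina.
have TR : 0 < T%:R :> R by rewrite ltr0n.
have -> : \sum_(1 <= t < T.+1) x t = T%:R *: xm.
  by rewrite scalerA divff ?gt_eqF// scale1r.
rewrite -!scalerBr sqr_l2norm !dotpZr => le_sum.
rewrite -(ler_pM2l TR).
have -> : T%:R * ((b + e0 / T%:R) * (V u y - V (a T) y) + delta) =
    (b * T%:R + e0) * (V u y - V (a T) y) + T%:R * delta.
  by field; rewrite gt_eqF.
move: le_sum; lra.
Qed.

(** As zb' - zl = c (xm - u), smoothness at zl bounds G zb' by the linearization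
of G at zl plus L c^2 / 2 |xm - u|^2. The linearization splits along
zb' = (1 - c) zb + c xm, and convexity bounds its two parts by G zb and G y. *)
Lemma outer_step (c D : R) zl zb zb' u xm y : 0 <= c <= 1 ->
  Z zb -> Z u -> Z xm -> Z y ->
  zl = (1 - c) *: zb + c *: u -> zb' = (1 - c) *: zb + c *: xm ->
  dotp (gradG zl + H y) (xm - y) + L * c / 2 * l2norm (xm - u) ^+ 2 <= D ->
  gap G H zb' y <= (1 - c) * gap G H zb y + c * D.
Proof.
move=> c01 Zzb Zu Zxm Zy zlE zb'E le_D.
have /andP[c0 c1] := c01.
have Zzl : Z zl by rewrite zlE; exact: convex_comb.
have Zzb' : Z zb' by rewrite zb'E; exact: convex_comb.
have /andP[_ Gzb'] := G_smooth Zzl Zzb'.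
have /andP[Gzb _] := G_smooth Zzl Zzb.
have /andP[Gy _] := G_smooth Zzl Zy.
have c1' : 0 <= 1 - c by rewrite subr_ge0.
have {}Gzb := mulr_ge0 c1' Gzb.
have {}Gy := mulr_ge0 c0 Gy.
have {}le_D := ler_wpM2l c0 le_D.
have zzE : zb' - zl = c *: (xm - u).
  by rewrite zlE zb'E opprD addrACA subrr add0r scalerBr.
have dotE v : dotp v (zb' - zl) =
    (1 - c) * dotp v (zb - zl) + c * dotp v (xm - zl).
  by rewrite {1}zb'E !dotp_linE; lra.
have HE : dotp (H y) (zb' - y) =
    (1 - c) * dotp (H y) (zb - y) + c * dotp (H y) (xm - y).
  by rewrite zb'E !dotp_linE; lra.
rewrite {}dotE {}zzE l2normZ// exprMn in Gzb'.
rewrite /gap {}HE.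
have dyE : dotp (gradG zl) (xm - y) =
    dotp (gradG zl) (xm - zl) - dotp (gradG zl) (y - zl).
  by rewrite !dotp_linE; lra.
rewrite dotpDl dyE in le_D.
move: Gzb Gy le_D Gzb'; move: (l2norm _ ^+ 2) => q; lra.
Qed.

Let p := sliding_params L M.

Lemma inner_steps_bounds k :
  k%:R * M / L <= (inner_steps p k)%:R <= k%:R * M / L + 1.
Proof.
apply: natr_ceil_bounds.
by rewrite divr_ge0 ?(ltW L_gt0)// mulr_ge0 ?(ltW M_gt0).
Qed.

Lemma inner_steps_gt0 k : (0 < k)%N -> (0 < inner_steps p k)%N.
Proof.
move=> k0; rewrite -(ltr0n R).
have /andP[+ _] := inner_steps_bounds k; apply: lt_le_trans.
by rewrite divr_gt0// mulr_gt0// ltr0n.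
Qed.

(** The rounding up in T_k = ceil (k M / L) makes eta_k^1 = L T_k / k at least M,
as the inner loop requires, while beta_k + eta_k^1 / T_k = 3 L / k holds exactly,
so the rounding does not affect the rate. *)
Lemma mps_run_outer_step z0 N s y k : (k < N)%N ->
  mps_run Z H gradG V p z0 N s -> Z (z s k) -> Z (zbar s k) -> Z y ->
  [/\ Z (z s k.+1), Z (zbar s k.+1) &
    gap G H (zbar s k.+1) y <= k%:R / k.+2%:R * gap G H (zbar s k) y +
      2 / k.+2%:R *
        (3 * L / k.+1%:R * (V (z s k) y - V (z s k.+1) y) + delta)].
Proof.
move=> kN run Zzk Zzbk Zy.
have kN1 : (1 <= k.+1 <= N)%N by [].
have := inner_steps_bounds k.+1; have := inner_steps_gt0 (ltn0Sn k).
have := run_zin run kN1; have := run_ztilin run kN1.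
have := run_zin0 run kN1; have := run_z run kN1.
have := run_ztil run kN1; have := run_zlow run kN1; have := run_zbar run kN1.
rewrite /p /=.
move: `|_|%N => T zbE zlE ztE zE a0 minx mina T0 /andP[Tge _].
have k1 : 0 < k.+1%:R :> R by rewrite ltr0n.
have k2 : k.+2%:R = k.+1%:R + 1 :> R by rewrite natr1.
have kE : k%:R = k.+1%:R - 1 :> R by rewrite -[k.+1%:R]natr1 addrK.
have TR : 0 < T%:R :> R by rewrite ltr0n.
have b0 : 0 <= 2 * L / k.+1%:R by rewrite divr_ge0 ?mulr_ge0 ?ltW.
have Me : M <= L * T%:R / k.+1%:R.
  by rewrite ler_pdivlMr// mulrC (mulrC L) -ler_pdivrMr.
have xZ t : (1 <= t <= T)%N -> Z (ztilin s k.+1 t) by move=> /minx[].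
have Zt : Z (ztil s k.+1) by rewrite ztE; exact: convex_mean.
have Zz : Z (z s k.+1).
  by rewrite zE; case: (mina T); rewrite // T0 leqnn.
have c01 : 0 <= (2 / k.+2%:R : R) <= 1.
  apply/andP; split; first exact: divr_ge0.
  by rewrite ler_pdivrMr ?ltr0n// mul1r ler_nat.
split => //; first by rewrite zbE; exact: convex_comb.
have -> : k%:R / k.+2%:R = 1 - 2 / k.+2%:R :> R.
  by rewrite kE k2; field; rewrite gt_eqF// addr_gt0.
apply: (outer_step c01 Zzbk Zzk Zt Zy zlE zbE).
have := inner_loop_mean T0 b0 Me Zzk Zy a0 minx mina.
rewrite -ztE -zE.
have -> : 2 * L / k.+1%:R + L * T%:R / k.+1%:R / T%:R = 3 * L / k.+1%:R.
  by field; rewrite !gt_eqF.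
(* The quadratic terms compare because L gamma_k <= beta_k. *)
apply: le_trans; rewrite lerD2l ler_wpM2r ?sqr_ge0//.
rewrite ler_pM2r ?invr_gt0// k2.
rewrite mulrA (mulrC L) ler_pM2l ?mulr_gt0// lef_pV2 ?posrE ?addr_gt0//.
by rewrite lerDl.
Qed.

(** The outer inequality weighted by k (k + 1) / 2: with 1 - gamma_k =
(k - 1) / (k + 1) both the gaps and the Bregman distances telescope. The weight
vanishes at k = 0, which starts the induction. *)
Lemma mps_run_gap z0 N s y : mps_run Z H gradG V p z0 N s -> Z z0 -> Z y ->
  forall k, (k <= N)%N ->
  [/\ Z (z s k), Z (zbar s k) &
    k%:R * k.+1%:R / 2 * gap G H (zbar s k) y + 3 * L * V (z s k) y
    <= 3 * L * V z0 y + k%:R * k.+1%:R / 2 * delta].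
Proof.
move=> run Zz0 Zy; elim=> [_|k IHk kN].
  by rewrite (run_z0 run) (run_zbar0 run) !mul0r add0r addr0.
have [Zzk Zzbk IH] := IHk (ltnW kN).
have [Zz Zzb step] := mps_run_outer_step kN run Zzk Zzbk Zy.
split => //.
have k1 : 0 < k.+1%:R :> R by rewrite ltr0n.
have k2 : 0 < k.+2%:R :> R by rewrite ltr0n.
have k12 : 0 <= k.+1%:R * k.+2%:R / 2 :> R by rewrite !mulr_ge0.
have {step} := ler_wpM2l k12 step.
have -> : k.+1%:R * k.+2%:R / 2 * (k%:R / k.+2%:R * gap G H (zbar s k) y +
      2 / k.+2%:R *
        (3 * L / k.+1%:R * (V (z s k) y - V (z s k.+1) y) + delta)) =
    k%:R * k.+1%:R / 2 * gap G H (zbar s k) y +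
    3 * L * (V (z s k) y - V (z s k.+1) y) + k.+1%:R * delta.
  by field; rewrite !gt_eqF.
rewrite -[k.+2%:R]natr1.
have -> : k.+1%:R = k%:R + 1 :> R by rewrite natr1.
rewrite -[k.+1%:R]natr1 in IH.
move: IH; lra.
Qed.

Lemma mps_gap_bound z0 N s y :
  mps_run Z H gradG V p z0 N s -> (0 < N)%N -> Z z0 -> Z y ->
  gap G H (zbar s N) y <= 6 * L * V z0 y / (N%:R * N.+1%:R) + delta.
Proof.
move=> run N0 Zz0 Zy.
have [ZzN _ IH] := mps_run_gap run Zz0 Zy (leqnn N).
have V0 : 0 <= V (z s N) y.
  by apply: le_trans (V_ge ZzN Zy); rewrite divr_ge0 ?sqr_ge0.
have {V0} := mulr_ge0 (ltW L_gt0) V0.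
have NN : 0 < N%:R * N.+1%:R :> R by rewrite mulr_gt0 ?ltr0n.
rewrite -lerBlDr ler_pdivlMr//; move: IH; lra.
Qed.

End Sliding.

(** * Oracle complexity *)

Section Counting.
Context {R : realType} {n : nat}.

Lemma size_gradG_calls N (s : mps_iterates R n) : size (gradG_calls N s) = N.
Proof. by rewrite size_map size_iota. Qed.

Lemma size_H_calls (p : mps_params R) N (s : mps_iterates R n) :
  size (H_calls p N s) = (\sum_(1 <= k < N.+1) 2 * inner_steps p k)%N.
Proof.
rewrite size_flatten /shape -map_comp sumnE big_map /index_iota subn1 /=.
apply: eq_bigr => k _; rewrite /= size_flatten /shape -map_comp sumnE big_map /=.
by rewrite big_const_seq count_predT size_iota iter_addn_0.
Qed.

Lemma size_H_calls_le (L M : R) N (s : mps_iterates R n) : 0 < M -> 0 < L ->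
  (size (H_calls (sliding_params L M) N s))%:R
    <= N%:R * N.+1%:R * M / L + 2 * N%:R :> R.
Proof.
move=> M0 L0; rewrite size_H_calls; elim: N => [|N IHN].
  by rewrite big_geq// !mul0r mulr0 addr0.
rewrite big_nat_recr//= natrD; move: IHN.
have /andP[_] := inner_steps_bounds M0 L0 N.+1.
rewrite natrM [inner_steps _ _]/=; move: (`|_|%N)%:R => T.
rewrite -[N.+2%:R]natr1.
have -> : N.+1%:R = N%:R + 1 :> R by rewrite natr1.
rewrite -!mulrA; lra.
Qed.

End Counting.

Theorem theorem2p6 (R : realType) :
  exists C1 C2 : R, [/\ 0 < C1, 0 < C2 &
  forall (n : nat) (Z : set 'rV[R]_n)
    (H : 'rV[R]_n -> 'rV[R]_n)
    (G : 'rV[R]_n -> R) (gradG : 'rV[R]_n -> 'rV[R]_n)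
    (d : 'rV[R]_n -> R) (gradd : 'rV[R]_n -> 'rV[R]_n)
    (M delta L eps : R) (z0 : 'rV[R]_n),
  let V := bregman d gradd in
  let Omega2 := sup [set V z0 x | x in Z] in
  closed Z -> convex_set Z ->
  is_gradient_on Z d gradd -> strongly_convex_on Z 1 d ->
  0 < M -> 0 < delta -> 0 < L ->
  (forall z1 z2, Z z1 -> Z z2 -> 0 <= dotp (H z2 - H z1) (z2 - z1)) ->
  (forall z1 z2 z3, Z z1 -> Z z2 -> Z z3 ->
     dotp (H z1 - H z2) (z1 - z3) <=
       M / 2 * l2norm (z1 - z2) ^+ 2 + M / 2 * l2norm (z1 - z3) ^+ 2 + delta) ->
  is_gradient_on Z G gradG ->
  (forall z1 z2, Z z1 -> Z z2 ->
     0 <= G z2 - G z1 - dotp (gradG z1) (z2 - z1) <=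
       L / 2 * l2norm (z2 - z1) ^+ 2) ->
  Z z0 ->
  has_ubound [set V z0 x | x in Z] ->
  0 < eps ->
  1 <= L * Omega2 / eps ->
  exists N : nat, (0 < N)%N /\
    forall s : mps_iterates R n,
      let p := sliding_params L M in
      mps_run Z H gradG V p z0 N s ->
      [/\ (ereal_sup [set (gap G H (zbar s N) x)%:E | x in Z]
             <= (eps + delta)%:E)%E,
          (size (gradG_calls N s))%:R <= C1 * Num.sqrt (L * Omega2 / eps) &
          (size (H_calls p N s))%:R <=
            C2 * (M * Omega2 / eps + Num.sqrt (L * Omega2 / eps))]].
Proof.
exists 4, 20; split=> // n Z H G gradG d gradd M delta L eps z0 V Omega2.
move=> _ cvxZ d_grad d_scvx M0 _ L0 H_mono H_bound _ G_smooth Zz0 ubV e0 Omega_ge1.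
pose x := Num.sqrt (L * Omega2 / eps).
have x1 : 1 <= x by rewrite -sqrtr1 ler_wsqrtr.
have x0 : 0 <= x by apply: le_trans x1.
have xx : L * Omega2 = eps * x ^+ 2.
  rewrite sqr_sqrtr; first by field; rewrite gt_eqF.
  exact: le_trans Omega_ge1.
(* The factor 3 makes N ^ 2 >= 9 x ^ 2, enough against the constant 6 of the gap
   bound, and x >= 1 absorbs the rounding into N <= 4 x. *)
pose N := `|Num.ceil (3 * x)|%N.
have /andP[N3x Nx] : 3 * x <= N%:R <= 3 * x + 1.
  by apply: natr_ceil_bounds; rewrite mulr_ge0.
have NR : 0 < N%:R :> R by apply: lt_le_trans N3x; lra.
have N0 : (0 < N)%N by rewrite -(ltr0n R).
have N4x : N%:R <= 4 * x by lra.
exists N; split=> // s p run; split; last first.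
- apply: le_trans (size_H_calls_le N s M0 L0) _; rewrite -/x.
  have -> : M * Omega2 / eps = x * x * (M / L).
    by field: xx; rewrite !gt_eqF.
  have ML : 0 <= M / L by rewrite divr_ge0 ?ltW.
  have NN : N%:R * N.+1%:R <= 20 * (x * x).
    by rewrite -natr1; nra.
  have := ler_wpM2r ML NN; rewrite -!mulrA; lra.
- by rewrite size_gradG_calls.
apply: ge_ereal_sup => _ [y Zy <-]; rewrite lee_fin.
apply: le_trans (mps_gap_bound cvxZ d_grad d_scvx M0 L0 H_mono H_bound
                   G_smooth run N0 Zz0 Zy) _.
have VO : V z0 y <= Omega2 by apply: ub_le_sup => //; exists y.
rewrite lerD2r ler_pdivrMr ?mulr_gt0 ?ltr0n//.
apply: (@le_trans _ _ (6 * L * Omega2)); first by rewrite ler_pM2l// mulr_gt0.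
rewrite -mulrA xx mulrCA ler_pM2l// -natr1; nra.
Qed.
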